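(* For every integer $k\ge 1$ there exist a connected directed graph $G=(V,E)$ on $|V|=3k+1$ nodes and a vector $c\in\mathbb{R}^{|E|}$ such that the circuit diameter of the dual network flow polyhedron $P_{G,c}$ satisfies $$\operatorname{diam}_{\mathcal{C}}(P_{G,c})\;\ge\;4k=|V|+k-1.$$
   Context: Directed graphs are finite, without loops and without parallel arcs: $E$ is a set of ordered pairs $ab$ of distinct nodes $a,b\in V$ (arc from tail $a$ to head $b$); both $ab$ and $ba$ may be present. ''Connected'' means that the underlying undirected graph is connected. One node of $V$ is designated as node $0$. For $c\in\mathbb{R}^{|E|}$, the dual network flow polyhedron is $$P_{G,c}=\{u\in\mathbb{R}^{|V|}: -u_a+u_b\le c_{ab}\ \text{ for all } ab\in E,\ u_0=0\}.$$ Circuits. For a polyhedron $P=\{z\in\mathbb{R}^n: A^1z=b^1,\ A^2z\ge b^2\}$ with rational matrices $A^1,A^2$, the set of circuits $\mathcal{C}(A^1,A^2)$ consists of those vectors $g\in\ker(A^1)\setminus\{0\}$, normalized to coprime integer components, for which $A^2g$ is support-minimal in the set $\{A^2x: x\in\ker(A^1)\setminus\{0\}\}$. For $P_{G,c}$ the matrices are those of its defining description above: $A^1u=b^1$ is the equation $u_0=0$ and $A^2u\ge b^2$ is the system $u_a-u_b\ge -c_{ab}$, $ab\in E$. Note that if $g$ is a circuit, so is $-g$. Circuit walks. For vertices $v^{(1)},v^{(2)}$ of $P$, a circuit walk of length $k$ from $v^{(1)}$ to $v^{(2)}$ is a sequence $v^{(1)}=y^{(0)},\dots,y^{(k)}=v^{(2)}$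 such that for all $i=0,\dots,k-1$: (1) $y^{(i)}\in P$; (2) $y^{(i+1)}-y^{(i)}=\alpha_i g^{(i)}$ for some $g^{(i)}\in\mathcal{C}(A^1,A^2)$ and $\alpha_i>0$; (3) $y^{(i)}+\alpha g^{(i)}\notin P$ for all $\alpha>\alpha_i$. The circuit distance from $v^{(1)}$ to $v^{(2)}$ is the minimum length of a circuit walk from $v^{(1)}$ to $v^{(2)}$, and the circuit diameter $\operatorname{diam}_{\mathcal{C}}(P)$ is the maximum circuit distance between any two vertices of $P$ (for a polyhedron $P$ that has at least one vertex). *)

(* Defs.v *)
From HB Require Import structures.
From mathcomp Require Import all_boot all_order all_algebra.
From mathcomp Require Import reals.

Set Implicit Arguments.
Unset Strict Implicit.
Unset Printing Implicit Defensive.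

Import Order.TTheory GRing.Theory Num.Theory.
Local Open Scope ring_scope.

(* A polyhedron {z | Aeq z = beq, Aineq z >= bineq} together with its
   description: circuits depend on the description, not only on the set. *)
Record polyhedron (R : realType) (n : nat) := Polyhedron {
  meq : nat;
  mineq : nat;
  Aeq : 'M[rat]_(meq, n);
  beq : 'cV[R]_meq;
  Aineq : 'M[rat]_(mineq, n);
  bineq : 'cV[R]_mineq
}.

Definition ratmx (R : realType) (m n : nat) (A : 'M[rat]_(m, n)) : 'M[R]_(m, n) :=
  map_mx (ratr : rat -> R) A.

Definition in_polyhedron (R : realType) (n : nat) (P : polyhedron R n)
    (z : 'cV[R]_n) : Prop :=
  ratmx R (Aeq P) *m z = beq P /\
  forall i, bineq P i 0 <= (ratmx R (Aineq P) *m z) i 0.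

Definition vertex (R : realType) (n : nat) (P : polyhedron R n)
    (v : 'cV[R]_n) : Prop :=
  in_polyhedron P v /\
  forall (x y : 'cV[R]_n) (t : R),
    in_polyhedron P x -> in_polyhedron P y -> 0 < t < 1 ->
    v = t *: x + (1 - t) *: y -> x = v /\ y = v.

Definition vsupp (R : realType) (m : nat) (w : 'cV[R]_m) : {set 'I_m} :=
  [set i | w i 0 != 0].

Definition coprime_integral (R : realType) (n : nat) (g : 'cV[R]_n) : Prop :=
  exists z : 'cV[int]_n,
    g = map_mx (intr : int -> R) z /\ \big[gcdn/0%N]_(i < n) absz (z i 0) = 1%N.

Definition circuit (R : realType) (n : nat) (P : polyhedron R n)
    (g : 'cV[R]_n) : Prop :=
  [/\ ratmx R (Aeq P) *m g = 0,
      g != 0,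
      coprime_integral g &
      forall x : 'cV[R]_n, ratmx R (Aeq P) *m x = 0 -> x != 0 ->
        ~~ (vsupp (ratmx R (Aineq P) *m x)
              \proper vsupp (ratmx R (Aineq P) *m g))].

Definition circuit_step (R : realType) (n : nat) (P : polyhedron R n)
    (y y' : 'cV[R]_n) : Prop :=
  exists (g : 'cV[R]_n) (alpha : R),
    [/\ circuit P g, 0 < alpha, y' - y = alpha *: g &
        forall beta : R, alpha < beta -> ~ in_polyhedron P (y + beta *: g)].

(* Only y 0, ..., y k matter. *)
Definition circuit_walk (R : realType) (n : nat) (P : polyhedron R n)
    (k : nat) (v1 v2 : 'cV[R]_n) : Prop :=
  exists y : nat -> 'cV[R]_n,
    [/\ y 0%N = v1, y k = v2 &
        forall i, (i < k)%N ->
          in_polyhedron P (y i) /\ circuit_step P (y i) (y i.+1)].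

Definition is_circuit_distance (R : realType) (n : nat) (P : polyhedron R n)
    (v1 v2 : 'cV[R]_n) (d : nat) : Prop :=
  circuit_walk P d v1 v2 /\ forall k, circuit_walk P k v1 v2 -> (d <= k)%N.

(* The maximum has to be attained, and every pair of vertices has to be joined
   by a circuit walk. *)
Definition is_circuit_diameter (R : realType) (n : nat) (P : polyhedron R n)
    (D : nat) : Prop :=
  (exists v1 v2 : 'cV[R]_n,
     [/\ vertex P v1, vertex P v2 & is_circuit_distance P v1 v2 D]) /\
  (forall v1 v2 : 'cV[R]_n, vertex P v1 -> vertex P v2 ->
     exists2 d, is_circuit_distance P v1 v2 d & (d <= D)%N).

(* A directed graph on the nodes 0, ..., n-1 is given by its set of arcs
   (tail, head). *)
Definition loopless (n : nat) (E : {set 'I_n * 'I_n}) : Prop :=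
  forall a : 'I_n, (a, a) \notin E.

Definition connected_digraph (n : nat) (E : {set 'I_n * 'I_n}) : Prop :=
  forall a b : 'I_n,
    connect (fun x y : 'I_n => ((x, y) \in E) || ((y, x) \in E)) a b.

Definition arc_tail (n : nat) (E : {set 'I_n * 'I_n}) (e : 'I_#|E|) : 'I_n :=
  (enum_val e).1.

Definition arc_head (n : nat) (E : {set 'I_n * 'I_n}) (e : 'I_#|E|) : 'I_n :=
  (enum_val e).2.

Definition dual_network_flow (R : realType) (n : nat)
    (E : {set 'I_n.+1 * 'I_n.+1}) (c : 'cV[R]_#|E|) : polyhedron R n.+1 :=
  Polyhedron
    (delta_mx 0 ord0 : 'M[rat]_(1, n.+1)) 0
    (\matrix_(e < #|E|, i < n.+1)
       ((i == arc_tail e)%:R - (i == arc_head e)%:R)) (- c).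

Lemma in_dual_network_flow (R : realType) (n : nat)
    (E : {set 'I_n.+1 * 'I_n.+1}) (c : 'cV[R]_#|E|) (u : 'cV[R]_n.+1) :
  in_polyhedron (dual_network_flow c) u <->
  (forall e : 'I_#|E|, - u (arc_tail e) 0 + u (arc_head e) 0 <= c e 0) /\
  u ord0 0 = 0.
Proof.
have H1 : ratmx R (Aeq (dual_network_flow c)) *m u = 0 <-> u ord0 0 = 0.
  have E1 : (ratmx R (Aeq (dual_network_flow c)) *m u) 0 0 = u ord0 0.
    rewrite mxE (bigD1 ord0) //= big1 => [|i ni0]; rewrite !mxE /=.
      by rewrite rmorph1 mul1r addr0.
    by rewrite (negPf ni0) rmorph0 mul0r.
  split=> [E0|u0]; first by rewrite -E1 E0 mxE.
  by apply/matrixP=> i j; rewrite !ord1 E1 u0 mxE.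
have H2 e : (ratmx R (Aineq (dual_network_flow c)) *m u) e 0 =
    u (arc_tail e) 0 - u (arc_head e) 0.
  have pick (a : 'I_n.+1) : \sum_i (i == a)%:R * u i 0 = u a 0.
    rewrite (bigD1 a) //= eqxx mul1r big1 ?addr0 // => i /negPf ->.
    by rewrite mul0r.
  rewrite mxE -!pick -sumrB; apply: eq_bigr => i _.
  by rewrite !mxE rmorphB /= !ratr_nat mulrBl.
split=> [[/H1 u0 ub]|[ub /H1 u0]]; split=> // e; have := ub e;
  rewrite H2 mxE.
  by rewrite lerNl opprB addrC.
by rewrite lerNl opprB addrC.
Qed.

(* Main.v *)
Require Import Defs.
From mathcomp Require Import all_boot all_order all_algebra.
From mathcomp Require Import boolp reals.
From mathcomp Require Import zify ring lra.

(** Glue [k] copies of one gadget at node [0].  The gadget is the complete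
    digraph on four nodes with the metric [dist] as arc costs, so its polytope
    is the set of 1-Lipschitz functions vanishing at node [0], with circuits
    [+- chi_S] for the nonempty sets [S] of nonzero nodes.  The metric was found
    by computer search: the vertices [(1, 2, 4)] and [(- 1, - 2, - 4)] are at
    circuit distance [4], and no two vertices are further apart.

    A circuit of the glued graph lives in a single copy and a maximal circuit
    step does not see the other copies, so walk lengths add up over the copies
    and the circuit diameter is exactly [4 * k].  Maximal steps from integer
    points lead to integer points, which makes the gadget a finite search;
    vertices are integral because otherwise moving a class of coordinates that
    agree modulo 1 keeps the point feasible in both directions. *)

Set Implicit Arguments.
Unset Strict Implicit.
Unset Printing Implicit Defensive.

Import Order.TTheory GRing.Theory Num.Theory.
Local Open Scope ring_scope.

(** * The gadget as a finite computation over integer triples *)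

Definition dist (i j : nat) : nat :=
  nth 0%N (nth [::] [:: [:: 0; 2; 2; 4]; [:: 2; 0; 2; 3];
                        [:: 2; 2; 0; 3]; [:: 4; 3; 3; 0]] i) j.

(* A point of the gadget polytope, [u 0 = 0] being left out: coordinates 1, 2, 3. *)
Definition triple (T : Type) := (T * T * T)%type.

Definition crd (T : nzRingType) (p : triple T) (i : nat) : T :=
  match i with 0 => 0 | 1 => p.1.1 | 2 => p.1.2 | _ => p.2 end.

Definition move (T : nzRingType) (p : triple T) (t : T) (g : triple T) :
    triple T :=
  (p.1.1 + t * g.1.1, p.1.2 + t * g.1.2, p.2 + t * g.2).

Definition pairs : seq (nat * nat) := [seq (i, j) | i <- iota 0 4, j <- iota 0 4].

Definition slack (T : nzRingType) (p : triple T) (e : nat * nat) : T :=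
  (dist e.1 e.2)%:R - (crd p e.2 - crd p e.1).

Definition feasible (T : numDomainType) (p : triple T) : bool :=
  all (fun e => 0 <= slack p e) pairs.

Definition subsets : seq (triple int) :=
  [:: (1, 0, 0); (0, 1, 0); (1, 1, 0); (0, 0, 1); (1, 0, 1); (0, 1, 1);
      (1, 1, 1)].

Definition directions : seq (triple int) :=
  subsets ++ [seq move (0, 0, 0) (- 1) g | g <- subsets].

(** These are the constraints whose slack shrinks at unit rate along [g]. By [directions_diff] no
    other rate of decrease occurs for a direction, so the ratio test in [max_step] needs no division
    and stays in the integers. *)
Definition tightening (g : triple int) : seq (nat * nat) :=
  [seq e <- pairs | crd g e.2 - crd g e.1 == 1].

(** The head serves as the starting value, so the result is the true minimum of a nonempty list; the
    empty list gives [0]. *)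
Definition seqmin (T : numDomainType) (s : seq T) : T :=
  foldr Num.min (head 0 s) s.

Definition max_step (p g : triple int) : int :=
  seqmin [seq slack p e | e <- tightening g].

Definition nexts (p : triple int) : seq (triple int) :=
  [seq move p (max_step p g) g | g <- directions & 0 < max_step p g].

Definition expand (s : seq (triple int)) : seq (triple int) :=
  undup (flatten [seq nexts q | q <- s]).

Definition symrange (n : nat) : seq int :=
  [seq i%:Z - n%:Z | i <- iota 0 n.*2.+1].

Definition box : seq (triple int) :=
  [seq (xy, z) | xy <- [seq (x, y) | x <- symrange 2, y <- symrange 2],
                 z <- symrange 4].

(** An active constraint that is not constant along [g] blocks the motion from [p] along [g] or
    along its opposite. *)
Definition tight (T : nzRingType) (p : triple T) (g : triple int) : bool :=
  has (fun e => (crd g e.2 != crd g e.1) && (slack p e == 0)) pairs.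

(** No circuit can be followed both ways from such a point. That these are exactly the vertices,
    block by block, is the content of [vertex_point] and [point_vertex]. *)
Definition vertices : seq (triple int) :=
  [seq p <- box | feasible p && all (tight p) subsets].

Definition far_start : triple int := (1, 2, 4).
Definition far_end : triple int := (- 1, - 2, - 4).

(** The trajectory of length [4] lists the iterates [0] to [3], so the search rules out every walk
    of at most three steps. *)
Lemma far_end_notin_expand :
  all (fun s => far_end \notin s) (traject expand [:: far_start] 4).
Proof. by vm_compute. Qed.

(** The trajectory of length [5] lists the iterates [0] to [4]: four steps always suffice. *)
Lemma vertices_within_expand4 :
  all (fun p => all (mem (flatten (traject expand [:: p] 5))) vertices) vertices.
Proof. by vm_compute. Qed.

Lemma directions_tightening : all (fun g => tightening g != [::]) directions.
Proof. by vm_compute. Qed.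

Lemma directions_diff :
  all (fun g => all (fun e => (crd g e.2 - crd g e.1) \in [:: 1; 0; - 1]) pairs)
    directions.
Proof. by vm_compute. Qed.

(** * Maximal steps from integer points, compared with real motion *)

Lemma seqmin_le (T : realDomainType) (s : seq T) x : x \in s -> seqmin s <= x.
Proof.
rewrite /seqmin; elim: s (head 0 s) => //= y s IHs z.
by rewrite inE ge_min => /orP[/eqP->|/IHs->]; rewrite ?lexx ?orbT.
Qed.

Lemma seqmin_mem (T : realDomainType) (s : seq T) : s != [::] -> seqmin s \in s.
Proof.
rewrite /seqmin; case: s => //= y s _.
suff H : foldr Num.min y s \in y :: s.
  by rewrite /Num.min; case: ifP => // _; rewrite mem_head.
elim: s => [|z s IHs] /=; first exact: mem_head.
rewrite /Num.min; case: ifP => _; first by rewrite !inE eqxx orbT.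
by move: IHs; rewrite !inE => /orP[->//|->]; rewrite !orbT.
Qed.

Lemma crd_move (T : nzRingType) (p g : triple T) t i :
  crd (move p t g) i = crd p i + t * crd g i.
Proof. by case: i => [|[|[|i]]] //=; rewrite mulr0 addr0. Qed.

Lemma triple_eq (T : nzRingType) (p q : triple T) :
  (forall i, (i < 4)%N -> crd p i = crd q i) -> p = q.
Proof.
case: p q => [[a b] c] [[a' b'] c'] H.
by rewrite [a](H 1%N) // [b](H 2%N) // [c](H 3%N).
Qed.

Lemma mem_pairs i j : ((i, j) \in pairs) = (i < 4)%N && (j < 4)%N.
Proof.
apply/allpairsP/andP => [[[a b] [Ha Hb [-> ->]]]|[Hi Hj]].
  by rewrite !mem_iota in Ha Hb.
by exists (i, j); rewrite !mem_iota.
Qed.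

Section Real.
Variable R : realType.

Definition to_real (p : triple int) : triple R := (p.1.1%:~R, p.1.2%:~R, p.2%:~R).

Lemma crd_to_real p i : crd (to_real p) i = (crd p i)%:~R.
Proof. by case: i => [|[|[|i]]]. Qed.

Lemma slack_to_real p e : slack (to_real p) e = (slack p e)%:~R.
Proof. by rewrite /slack !crd_to_real !rmorphB /= rmorph_nat. Qed.

Lemma feasible_to_real p : feasible (to_real p) = feasible p.
Proof. by apply: eq_all => e; rewrite slack_to_real ler0z. Qed.

Lemma slack_move (p g : triple R) t e :
  slack (move p t g) e = slack p e - t * (crd g e.2 - crd g e.1).
Proof. by rewrite /slack !crd_move; ring. Qed.

Lemma to_real_move p t g : to_real (move p t g) = move (to_real p) t%:~R (to_real g).
Proof. by rewrite /to_real /move /= !rmorphD !rmorphM. Qed.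

(** Only the slacks of [tightening g] decrease, each by exactly [t]; the remaining ones stay or
    grow. The minimum is attained by a constraint, which gives the bound on [t]. *)
Lemma feasible_move p g (t : R) : feasible p -> g \in directions -> 0 <= t ->
  feasible (move (to_real p) t (to_real g)) = (t <= (max_step p g)%:~R).
Proof.
move=> fp gD t0; apply/idP/idP => [/allP ft|tM].
  have : max_step p g \in [seq slack p e | e <- tightening g].
    apply: seqmin_mem; have := allP directions_tightening _ gD.
    by case: (tightening g).
  case/mapP=> e; rewrite mem_filter => /andP[/eqP ge eP] ->.
  move: (ft e eP); rewrite slack_move !crd_to_real -rmorphB ge /= mulr1.
  by rewrite slack_to_real subr_ge0.
apply/allP => e eP; rewrite slack_move !crd_to_real -rmorphB slack_to_real /=.
have s0 : 0 <= (slack p e)%:~R :> R by rewrite ler0z (allP fp).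
have := allP (allP directions_diff _ gD) _ eP.
rewrite !inE => /or3P[] /eqP ge; rewrite ge /=.
- have : max_step p g <= slack p e.
    by apply/seqmin_le/map_f; rewrite mem_filter ge eqxx.
  by rewrite -(ler_int R); lra.
- by rewrite mulr0 subr0.
by rewrite mulrN1 opprK addr_ge0.
Qed.

End Real.

Definition indicator (f : nat -> bool) : triple int :=
  (Posz (f 1%N), Posz (f 2%N), Posz (f 3%N)).

Lemma crd_indicator f i : f 0%N = false -> (i < 4)%N ->
  crd (indicator f) i = Posz (f i).
Proof. by move=> f0; case: i => [|[|[|[|i]]]] //=; rewrite f0. Qed.

Lemma indicator_subsets f i : f 0%N = false -> (i < 4)%N -> f i ->
  indicator f \in subsets.
Proof.
rewrite /indicator => f0 i4 fi.
have : f 1%N || f 2%N || f 3%N.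
  by case: i i4 fi => [|[|[|[|i]]]] //; rewrite ?f0 // => _ ->; rewrite ?orbT.
by case: (f 1%N) (f 2%N) (f 3%N) => [] [] [].
Qed.

(** Each direction is a sign [s] times the indicator of a nonempty set; this is the form used to
    show that it is a circuit. *)
Lemma directions_sign : all (fun g => has (fun s =>
    all (fun i => crd g i \in [:: 0; s]) (iota 0 4) &&
    has (fun i => crd g i == s) (iota 0 4)) [:: 1; - 1]) directions.
Proof. by vm_compute. Qed.

(** * The glued graph, its polyhedron and its circuits *)

Section Graph.
Variables (R : realType) (k : nat).

(** Place [0] is the same node for all copies. The nonzero nodes are numbered by the pairs (copy,
    place), the place being shifted down by one to fit ['I_3]. *)
Definition node (b : 'I_k) (i : nat) : 'I_(k * 3).+1 :=
  if i is i'.+1 then lift ord0 (mxvec_index b (inord i' : 'I_3)) else ord0.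

Definition unindex (j : 'I_(k * 3)) : 'I_k * 'I_3 :=
  enum_val (cast_ord (esym (mxvec_cast k 3)) j).

Definition place (x : 'I_(k * 3).+1) : nat :=
  if unlift ord0 x is Some j then (unindex j).2.+1 else 0.

Definition glue (F : 'I_k -> triple R) : 'cV[R]_(k * 3).+1 :=
  \col_x (if unlift ord0 x is Some j then crd (F (unindex j).1) (unindex j).2.+1
          else 0).

Lemma mxvec_indexK b i : unindex (mxvec_index b i) = (b, i).
Proof. by rewrite /unindex /mxvec_index cast_ordK enum_rankK. Qed.

Lemma place_node b i : (i < 4)%N -> place (node b i) = i.
Proof.
rewrite /place; case: i => [|i] i4 /=; first by rewrite unlift_none.
by rewrite liftK mxvec_indexK /= inordK.
Qed.

Lemma glueE F b i : (i < 4)%N -> glue F (node b i) 0 = crd (F b) i.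
Proof.
rewrite mxE; case: i => [|i] i4 /=; first by rewrite unlift_none.
by rewrite liftK mxvec_indexK /= inordK.
Qed.

(** Writing node [0] in the form [node b 0] takes some copy, which [b0] supplies; [node_neq0] gets
    the copy from the node itself. *)
Lemma nodeP (b0 : 'I_k) x : exists b i, (i < 4)%N /\ x = node b i.
Proof.
have [j ->|->] := unliftP ord0 x; last by exists b0, 0%N.
case/mxvec_indexP: j => b i; exists b, i.+1.
split => //=; first by rewrite !ltnS -ltnS ltn_ord.
by rewrite inord_val.
Qed.

Lemma node_neq0 x : x != ord0 -> exists b i, (i < 4)%N /\ x = node b i.
Proof.
have [j ->|->] := unliftP ord0 x; last by rewrite eqxx.
by case/mxvec_indexP: j => b i _; apply: nodeP.
Qed.

Lemma node_eq0 b i : (i < 4)%N -> (node b i == ord0) = (i == 0)%N.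
Proof. by case: i => [|i] _ //; apply/negbTE; rewrite eq_sym neq_lift. Qed.

Lemma glueP (u : 'cV[R]_(k * 3).+1) : u ord0 0 = 0 -> exists F, u = glue F.
Proof.
move=> u0; exists (fun b => (u (node b 1) 0, u (node b 2) 0, u (node b 3) 0)).
apply/colP => x; have [->|/node_neq0[b [i [i4 ->]]]] := eqVneq x ord0.
  by rewrite mxE unlift_none.
by rewrite glueE //; case: i i4 => [|[|[|[|i]]]].
Qed.

Lemma glue0 F : glue F ord0 0 = 0.
Proof. by rewrite mxE unlift_none. Qed.

Lemma eq_glue F G : F =1 G -> glue F = glue G.
Proof.
by move=> FG; apply/colP => x; rewrite !mxE; case: (unlift _ _) => // j; rewrite FG.
Qed.

Lemma glue_move F G t :
  glue F + t *: glue G = glue (fun b => move (F b) t (G b)).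
Proof.
apply/colP => x; have [->|/node_neq0[b [i [i4 ->]]]] := eqVneq x ord0.
  by rewrite !mxE unlift_none; ring.
by rewrite [LHS]mxE [X in _ + X]mxE !glueE // crd_move.
Qed.

Lemma glue_inj F G : glue F = glue G -> F =1 G.
Proof. by move=> E b; apply: triple_eq => i i4; rewrite -!glueE // E. Qed.

Definition arcs : {set 'I_(k * 3).+1 * 'I_(k * 3).+1} :=
  [set xy | [exists b : 'I_k, exists i : 'I_4, exists j : 'I_4,
     (i != j) && (xy == (node b i, node b j))]].

Definition cost : 'cV[R]_#|arcs| :=
  \col_e (dist (place (arc_tail e)) (place (arc_head e)))%:R.

Definition gadgets := dual_network_flow cost.

Lemma mem_arcs b i j : (i < 4)%N -> (j < 4)%N -> i != j ->
  (node b i, node b j) \in arcs.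
Proof.
move=> i4 j4 ij; rewrite inE; apply/existsP; exists b.
by apply/existsP; exists (Ordinal i4); apply/existsP; exists (Ordinal j4); apply/andP.
Qed.

Lemma arcsP xy : xy \in arcs ->
  exists b i j, [/\ (i < 4)%N, (j < 4)%N, i != j & xy = (node b i, node b j)].
Proof.
rewrite inE => /existsP[b /existsP[i /existsP[j /andP[ij /eqP ->]]]].
by exists b, i, j; split.
Qed.

Lemma arc_of b i j : (i < 4)%N -> (j < 4)%N -> i != j ->
  exists e : 'I_#|arcs|, arc_tail e = node b i /\ arc_head e = node b j.
Proof.
move=> i4 j4 ij; have A := mem_arcs b i4 j4 ij.
exists (enum_rank_in A (node b i, node b j)).
by rewrite /arc_tail /arc_head enum_rankK_in.
Qed.

Lemma arc_ends (e : 'I_#|arcs|) : exists b i j,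
  [/\ (i < 4)%N, (j < 4)%N, i != j & arc_tail e = node b i /\ arc_head e = node b j].
Proof.
have [b [i [j [i4 j4 ij E]]]] := arcsP (enum_valP e).
by exists b, i, j; split => //; rewrite /arc_tail /arc_head E.
Qed.

Lemma loopless_arcs : loopless arcs.
Proof.
move=> a; apply/negP => /arcsP[b [i [j [i4 j4 ij [E1 E2]]]]].
by move: ij; rewrite -(place_node b i4) -(place_node b j4) -E1 -E2 eqxx.
Qed.

Lemma connected_arcs : connected_digraph arcs.
Proof.
have H x : x != ord0 -> (x, ord0) \in arcs /\ (ord0, x) \in arcs.
  move=> x0; have [b [i [i4 Ex]]] := node_neq0 x0.
  have i0 : i != 0%N by rewrite -(node_eq0 b i4) -Ex.
  rewrite Ex; split; first exact: (@mem_arcs b i 0%N).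
  by apply: (@mem_arcs b 0%N i) => //; rewrite eq_sym.
move=> a b; apply: (@connect_trans _ _ ord0).
  by have [->//|/H[aE _]] := eqVneq a ord0; apply: connect1; rewrite aE.
by have [->//|/H[_ bE]] := eqVneq b ord0; apply: connect1; rewrite bE.
Qed.

Lemma in_gadgets F :
  in_polyhedron gadgets (glue F) <-> forall b, feasible (F b).
Proof.
rewrite in_dual_network_flow glue0; split => [[ub _] b|H].
  apply/allP => -[i j]; rewrite mem_pairs => /andP[i4 j4].
  have [->|ij] := eqVneq i j.
    by rewrite /slack subrr subr0 ler0n.
  have [e [et eh]] := arc_of b i4 j4 ij; have := ub e.
  by rewrite [X in _ <= X]mxE et eh !glueE // !place_node // /slack /=; lra.
split=> // e; have [b [i [j [i4 j4 ij [et eh]]]]] := arc_ends e.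
rewrite [X in _ <= X]mxE et eh !glueE // !place_node //.
have /allP/(_ (i, j)) := H b; rewrite mem_pairs i4 j4 => /(_ isT).
by rewrite /slack /=; lra.
Qed.

Lemma Aeq_gadgets (u : 'cV[R]_(k * 3).+1) :
  ratmx R (Aeq gadgets) *m u = 0 <-> u ord0 0 = 0.
Proof.
have -> : ratmx R (Aeq gadgets) *m u = row ord0 u by rewrite rowE /ratmx map_delta_mx.
split=> [/rowP/(_ 0)|u0]; first by rewrite !mxE.
by apply/rowP => i; rewrite ord1 !mxE.
Qed.

Lemma mem_vsupp (u : 'cV[R]_(k * 3).+1) e :
  (e \in vsupp (ratmx R (Aineq gadgets) *m u)) = (u (arc_tail e) 0 != u (arc_head e) 0).
Proof.
have pick (a : 'I_(k * 3).+1) : \sum_i (i == a)%:R * u i 0 = u a 0.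
  rewrite (bigD1 a) //= eqxx mul1r big1 ?addr0 // => i /negPf ->.
  by rewrite mul0r.
rewrite inE -[in RHS]subr_eq0 mxE -!pick -sumrB; congr (_ != 0); apply: eq_bigr => i _.
by rewrite !mxE rmorphB /= !ratr_nat mulrBl.
Qed.

Definition single (b : 'I_k) (g : triple int) : 'I_k -> triple R :=
  fun b' => if b' == b then to_real R g else 0.

Lemma crd0 i : crd (0 : triple R) i = 0.
Proof. by case: i => [|[|[|i]]]. Qed.

Lemma crd_single b g b' i : crd (single b g b') i = (if b' == b then crd g i else 0)%:~R.
Proof. by rewrite /single; case: ifP => _; rewrite ?crd_to_real ?crd0. Qed.

Lemma glue_neq0 (F : 'I_k -> triple R) b i : (i < 4)%N -> crd (F b) i != 0 -> glue F != 0.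
Proof. by move=> i4; apply: contraNneq => E; rewrite -glueE // E mxE. Qed.

(* If [a] is a nonzero entry of the circuit [g] in block [b], the indicator of
   [{g = a}] in that block has no larger support, so support-minimality forces
   [g] to be [a] times it, and coprimality forces [a = 1] or [a = - 1]. *)
Lemma circuit_single (g : 'cV[R]_(k * 3).+1) : circuit gadgets g ->
  exists b h, h \in directions /\ g = glue (single b h).
Proof.
case=> /Aeq_gadgets g0 gN0 [z [gz zgcd]] gmin.
have [G EG] := glueP g0.
have [b [i0 [i04 a0]]] : exists b i, (i < 4)%N /\ crd (G b) i != 0.
  have /matrix0Pn[x [y]] := gN0; rewrite ord1 => {y} gx.
  have /node_neq0[b [i [i4 Ex]]] : x != ord0 by apply: contraNneq gx => ->; rewrite g0.
  by exists b, i; split => //; rewrite -glueE // -EG -Ex.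
set a := crd (G b) i0 in a0.
pose f i := crd (G b) i == a.
have f0 : f 0%N = false by rewrite /f eq_sym; apply/negbTE.
have hS : indicator f \in subsets by apply: (indicator_subsets f0 i04); apply: eqxx.
pose x := glue (single b (indicator f)).
have xE b' i : (i < 4)%N -> x (node b' i) 0 = ((b' == b) && f i)%:R.
  move=> i4; rewrite glueE // crd_single; case: eqP => _ //=.
  by rewrite crd_indicator // pmulrn.
have xN0 : x != 0.
  apply: (glue_neq0 (b := b) i04).
  by rewrite crd_single eqxx crd_indicator // /f eqxx oner_eq0.
have /gmin/(_ xN0) : ratmx R (Aeq gadgets) *m x = 0 by apply/Aeq_gadgets; apply: glue0.
rewrite properE negb_and negbK => /orP[/subsetPn[e]|/subsetP gx].
  rewrite !mem_vsupp negbK => + /eqP Eg.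
  have [b' [i [j [i4 j4 _ [et eh]]]]] := arc_ends e.
  move: Eg; rewrite et eh EG !(glueE G) // !xE // => Eg.
  by case: (b' =P b) => [bb|_] /=; rewrite ?eqxx // /f -bb Eg eqxx.
have gE y : g y 0 = a * x y 0.
  have [->|/node_neq0[b' [i [i4 ->]]]] := eqVneq y ord0; first by rewrite g0 glue0 mulr0.
  rewrite xE //; case: (boolP ((b' == b) && f i)) => [/andP[/eqP-> /eqP fi]|xi].
    by rewrite EG (glueE G) // fi mulr1.
  rewrite mulr0; have [->|i0N] := eqVneq i 0%N; first by rewrite -g0.
  (* Where [x] vanishes, the arc from node [0] is outside the support of [x], hence outside that of
     [g], so [g] has there its value [0] at node [0]. *)
  have [e [et eh]] := arc_of b' i4 (isT : (0 < 4)%N) i0N.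
  apply/eqP/negP => /negP gi; have /gx : e \in vsupp (ratmx R (Aineq gadgets) *m g).
    by rewrite mem_vsupp et eh g0.
  by rewrite mem_vsupp et eh glue0 xE // (negbTE xi) eqxx.
have gaE : g = a *: x by apply/colP => y; rewrite gE [RHS]mxE.
have za : a = (z (node b i0) 0)%:~R.
  by rewrite /a -glueE // -EG gz mxE.
have a1 : `|z (node b i0) 0%R|%N = 1%N.
  apply/eqP; rewrite -dvdn1 -[X in (_ %| X)%N]zgcd; apply/dvdn_biggcdP => y _.
  have : (z y 0)%:~R = a * x y 0 by rewrite -gE gz mxE.
  have [->|/node_neq0[b' [i [i4 ->]]]] := eqVneq y ord0.
    by rewrite glue0 mulr0 => /eqP; rewrite intr_eq0 => /eqP->.
  rewrite xE // za; case: (_ && _); rewrite ?mulr1 ?mulr0 => /eqP.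
    by rewrite eqr_int => /eqP->.
  by rewrite intr_eq0 => /eqP->.
have [a1'|a1'] : a = 1 \/ a = - 1.
  by rewrite za; case: (z _ _) a1 => n /= => [->|[->]]; [left|right].
  exists b, (indicator f); split; first by rewrite mem_cat hS.
  by rewrite gaE a1' scale1r.
exists b, (move (0, 0, 0) (- 1) (indicator f)); split.
  by rewrite mem_cat; apply/orP; right; apply: map_f.
apply/colP => y; rewrite gE a1' mulN1r.
have [->|/node_neq0[b' [i [i4 ->]]]] := eqVneq y ord0; first by rewrite !glue0 oppr0.
rewrite !glueE // !crd_single crd_move; case: ifP => _ //=; last by rewrite oppr0.
by case: i i4 => [|[|[|[|i]]]] //= _; rewrite ?add0r ?mulN1r ?rmorphN ?oppr0.
Qed.

(** A vector with no larger support is constant on both level sets of [h] in block [b] and vanishes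
    on the other blocks, since each copy is a complete digraph. It is thus a multiple of the glued
    direction, and if nonzero it has the same support. An entry [1] or [- 1] gives coprimality. *)
Lemma single_circuit b h : h \in directions -> circuit gadgets (glue (single b h)).
Proof.
move=> hD; have /hasP[s s1 /andP[/allP hs /hasP[i0]]] := allP directions_sign _ hD.
rewrite mem_iota => i04 /eqP hi0.
have ss : s * s = 1 by move: s1; rewrite !inE => /orP[] /eqP->.
have s0 : s != 0 by apply: contra_eq_neq ss => ->.
have gN0 : glue (single b h) != 0.
  by apply: (glue_neq0 (b := b) i04); rewrite crd_single eqxx hi0 intr_eq0.
split=> //; first by apply/Aeq_gadgets; apply: glue0.
  pose z : 'cV[int]_(k * 3).+1 := \col_x (if unlift ord0 x is Some j then
    (if (unindex j).1 == b then crd h (unindex j).2.+1 else 0) else 0).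
  have zE : glue (single b h) = map_mx (intr : int -> R) z.
    apply/colP => x; rewrite !mxE; case: (unlift _ _) => // j.
    by rewrite crd_single.
  exists z.
  split=> //; apply/eqP; rewrite -dvdn1.
  have : (z (node b i0) 0)%:~R = s%:~R :> R.
    move/colP: zE => /(_ (node b i0)).
    by rewrite glueE // crd_single eqxx hi0 [RHS]mxE => ->.
  move/eqP; rewrite eqr_int => /eqP zs; apply: (biggcdn_inf (node b i0)) => //.
  by rewrite zs; move: s1; rewrite !inE => /orP[] /eqP->.
move=> x /Aeq_gadgets x0 xN0; apply/negP => /properP[/subsetP sub [e eg ex]].
have arcE b' i j : (i < 4)%N -> (j < 4)%N ->
    crd (single b h b') i = crd (single b h b') j -> x (node b' i) 0 = x (node b' j) 0.
  move=> i4 j4 E; have [->//|ij] := eqVneq i j.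
  have [e' [et eh]] := arc_of b' i4 j4 ij; apply/eqP/negP => /negP xij.
  have /sub : e' \in vsupp (ratmx R (Aineq gadgets) *m x) by rewrite mem_vsupp et eh.
  by rewrite mem_vsupp et eh !glueE // E eqxx.
(* The factor is the quotient of the values at [node b i0]: the direction has value [s] there, and
   [s] is its own inverse. *)
have xE y : x y 0 = (s%:~R * x (node b i0) 0) * glue (single b h) y 0.
  have [->|/node_neq0[b' [i [i4 ->]]]] := eqVneq y ord0; first by rewrite x0 glue0 mulr0.
  rewrite glueE //; have := arcE b' i 0%N i4 isT.
  have := arcE b' i i0 i4 i04; rewrite !crd_single.
  have := hs i; rewrite mem_iota i4 !inE => /(_ isT).
  case: (b' =P b) => [->|_]; last by move=> _ _ /(_ erefl); rewrite x0 mulr0.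
  case/orP => /eqP->; first by move=> _ /(_ erefl); rewrite x0 mulr0.
  rewrite hi0 => /(_ erefl)-> _; rewrite mulrAC -rmorphM /= ss mul1r //.
have t0 : s%:~R * x (node b i0) 0 != 0.
  by apply: contraNneq xN0 => t0; apply/eqP/colP => y; rewrite xE t0 mul0r mxE.
move: eg ex; rewrite !mem_vsupp negbK => eg.
rewrite (xE (arc_tail e)) (xE (arc_head e)) => /eqP/(mulfI t0)/eqP.
by rewrite (negbTE eg).
Qed.

End Graph.

(** * Circuit walks in an arbitrary polyhedron *)

Lemma walk_cat (R : realType) n (P : polyhedron R n) l m u v w :
  circuit_walk P l u v -> circuit_walk P m v w -> circuit_walk P (l + m) u w.
Proof.
move=> [x [x0 xl xs]] [y [y0 ym ys]].
(* Index [l] is already read from the second walk, which starts where the first one ends. *)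
exists (fun i => if (i < l)%N then x i else y (i - l)%N); split.
- by case: (posnP l) => [l0|//]; rewrite sub0n y0 -xl l0.
- by rewrite ltnNge leq_addr addKn.
move=> i ilm; case: (ltnP i l) => [il|li].
  have := xs i il; case: (ltnP i.+1 l) => // li.
  have -> : i.+1 = l by apply/eqP; rewrite eqn_leq il.
  by rewrite subnn y0 -xl.
by rewrite ltnNge ltnW ?ltnS //= subSn //; apply: ys; rewrite ltn_subLR.
Qed.

(** Strong induction on the length; excluded middle decides whether a shorter walk exists. *)
Lemma walk_circuit_distance (R : realType) n (P : polyhedron R n) m u v :
  circuit_walk P m u v -> exists2 d, is_circuit_distance P u v d & (d <= m)%N.
Proof.
elim/ltn_ind: m => m IHm Wm.
have [[l [lm Wl]]|H] := pselect (exists l, (l < m)%N /\ circuit_walk P l u v).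
  by have [d Hd dl] := IHm l lm Wl; exists d => //; apply: leq_trans (ltnW lm).
exists m => //; split=> // l Wl; rewrite leqNgt; apply/negP => lm.
by apply: H; exists l.
Qed.

(** * Vertices of the gadget: integrality and extremality *)

Lemma mem_symrange (n : nat) (x : int) : - n%:Z <= x -> x <= n%:Z -> x \in symrange n.
Proof.
move=> nx xn; apply/mapP; exists (absz (x + n%:Z)); last by lia.
by rewrite mem_iota; lia.
Qed.

Lemma feasible_box p : feasible p -> p \in box.
Proof.
move=> /allP fp; case: p fp => [[x y] z] fp.
have H i j : (i < 4)%N && (j < 4)%N -> 0 <= slack (x, y, z) (i, j).
  by rewrite -mem_pairs; apply: fp.
have := (H 0%N 1%N isT, H 1%N 0%N isT, H 0%N 2%N isT, H 2%N 0%N isT).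
have := (H 0%N 3%N isT, H 3%N 0%N isT).
rewrite /slack /dist /= => -[z1 z2] [[[x1 x2] y1] y2].
have xI : x \in symrange 2 by apply: mem_symrange; lia.
have yI : y \in symrange 2 by apply: mem_symrange; lia.
have zI : z \in symrange 4 by apply: mem_symrange; lia.
by apply/allpairsP; exists ((x, y), z); split => //; apply/allpairsP; exists (x, y).
Qed.

Lemma mem_expand s p q : p \in s -> q \in nexts p -> q \in expand s.
Proof.
by move=> ps qp; rewrite mem_undup; apply/flattenP; exists (nexts p) => //; apply: map_f.
Qed.

Lemma expandP s q : q \in expand s -> exists2 p, p \in s & q \in nexts p.
Proof. by rewrite mem_undup => /flattenP[t /mapP[p ps ->] qt]; exists p. Qed.

Lemma mem_directions g : g \in subsets -> g \in directions.
Proof. by rewrite mem_cat => ->. Qed.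

Section Vertices.
Variable R : realType.
Implicit Types p : triple R.

Lemma perturb p g : feasible p -> g \in subsets -> ~~ tight p g ->
  exists2 t : R, 0 < t & feasible (move p t (to_real R g)) /\
                         feasible (move p (- t) (to_real R g)).
Proof.
move=> /allP fp gS /hasPn nt.
(* The step is the least slack of a constraint that varies along [g], which is positive as [g] is
   not tight. The entry [1] keeps the list nonempty. *)
pose s := 1 :: [seq slack p e | e <- pairs & crd g e.2 != crd g e.1].
have t0 : 0 < seqmin s.
  have /(_ isT) := @seqmin_mem _ s; rewrite inE => /orP[/eqP->//|/mapP[e]].
  rewrite mem_filter => /andP[ge eP] ->; rewrite lt_neqAle fp // andbT eq_sym.
  by have := nt e eP; rewrite ge.
have H e : e \in pairs -> crd g e.2 != crd g e.1 -> seqmin s <= slack p e.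
  by move=> eP ge; apply: seqmin_le; rewrite inE map_f ?orbT // mem_filter ge.
have small e : e \in pairs ->
    `|seqmin s * (crd g e.2 - crd g e.1)%:~R| <= slack p e.
  move=> eP; have := allP (allP directions_diff _ (mem_directions gS)) _ eP.
  have [ge|ge] := eqVneq (crd g e.2) (crd g e.1).
    by rewrite ge subrr mulr0 normr0 => _; apply: fp.
  rewrite !inE subr_eq0 (negbTE ge) => /orP[] /eqP->;
    by rewrite /= ?mulrN1 ?mulr1 ?normrN gtr0_norm // H.
exists (seqmin s) => //.
split; apply/allP => e eP; rewrite slack_move !crd_to_real -rmorphB /=;
  by have := small e eP; rewrite ler_norml => /andP[]; lra.
Qed.

(** The class modulo 1 of a nonintegral coordinate avoids node [0], so its indicator is in
    [subsets]. A tight constraint crossing the class would have an integral difference, which keeps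
    both ends in the same class. *)
Lemma tight_integral p : feasible p -> (forall g, g \in subsets -> tight p g) ->
  exists2 q, q \in vertices & p = to_real R q.
Proof.
move=> fp tp.
have pint i : (i < 4)%N -> crd p i \is a Num.int.
  move=> i4; apply/negPn/negP => pi.
  pose f j := crd p j - crd p i \is a Num.int.
  have f0 : f 0%N = false by rewrite /f /= sub0r rpredN; apply/negbTE.
  have fi : f i by rewrite /f subrr rpred0.
  have /hasP[[a b]] := tp _ (indicator_subsets f0 i4 fi).
  rewrite mem_pairs => /andP[a4 b4] /=; rewrite !crd_indicator // => /andP[/negP + /eqP].
  rewrite /slack /= => fab sab; apply: fab.
  have -> : f b = f a; last by [].
  have E : crd p b - crd p i = (dist a b)%:R + (crd p a - crd p i) by lra.
  by rewrite /f E rpredDl ?natr_int.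
have [x px] := intrP (pint 1%N isT); have [y py] := intrP (pint 2%N isT).
have [z pz] := intrP (pint 3%N isT).
have pq : p = to_real R (x, y, z).
  by case: p px py pz {fp tp pint} => [[p1 p2] p3] /= -> -> ->.
exists (x, y, z) => //; have fq : feasible (x, y, z) by rewrite -(feasible_to_real R) -pq.
rewrite mem_filter fq feasible_box // andbT; apply/allP => g /tp /hasP[e eP].
by rewrite pq slack_to_real intr_eq0 => H; apply/hasP; exists e.
Qed.

(** If [p] differs from [q] somewhere, a constraint tight at [q] crosses the set where they differ.
    It is tight at [p] and [p'] as well, so [p] and [q] have the same difference along it and differ
    at both ends or at neither. *)
Lemma vertices_rigid q p p' (t : R) : q \in vertices -> feasible p -> feasible p' ->
  0 < t -> t < 1 ->
  (forall i, (i < 4)%N -> crd (to_real R q) i = t * crd p i + (1 - t) * crd p' i) ->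
  p = to_real R q.
Proof.
rewrite mem_filter => /andP[/andP[_ /allP eq] _] /allP fp /allP fp' t0 t1 E.
apply: triple_eq => i i4; apply/eqP/negPn/negP => pi.
pose f j := crd p j != crd (to_real R q) j.
have f0 : f 0%N = false by rewrite /f /= eqxx.
have /hasP[[a b] abP] := eq _ (indicator_subsets f0 i4 pi).
have := abP; rewrite mem_pairs => /andP[a4 b4] /=.
rewrite !crd_indicator // => /andP[/negP fab].
rewrite -(intr_eq0 R) -slack_to_real => /eqP sab.
apply: fab; have -> : f b = f a; last by [].
move: (fp _ abP) (fp' _ abP) sab; rewrite /f /slack /= !E //.
set d := (dist a b)%:R; set xa := crd p a; set xb := crd p b.
set ya := crd p' a; set yb := crd p' b => h h' hs.
(* The slack at [q], which is zero, is a convex combination of the nonnegative slacks at [p] and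
   [p']. *)
have hx : t * (d - (xb - xa)) = 0.
  by apply/eqP; rewrite eq_le mulr_ge0 ?(ltW t0) // andbT; nra.
have {hx} hx : d - (xb - xa) = 0 by move/eqP: hx; rewrite mulf_eq0 gt_eqF //= => /eqP.
have hy : (1 - t) * (yb - ya) = (1 - t) * d.
  have : (1 - t) * d = (1 - t) * (yb - ya)
      + (d - (t * xb + (1 - t) * yb - (t * xa + (1 - t) * ya)))
      - t * (d - (xb - xa)) by ring.
  by rewrite hs hx; lra.
have {}hx : xb = xa + d by lra.
have -> : (xb != t * xb + (1 - t) * yb) = ((1 - t) * yb != (1 - t) * xb).
  by congr (~~ _); apply/eqP/eqP; lra.
have -> : (xa != t * xa + (1 - t) * ya) = ((1 - t) * ya != (1 - t) * xa).
  by congr (~~ _); apply/eqP/eqP; lra.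
by congr (~~ _); apply/eqP/eqP; rewrite hx; nra.
Qed.

End Vertices.

(** * Walks and vertices of the glued polyhedron, block by block *)

Section Walks.
Variables (R : realType) (k : nat).
Implicit Types f : 'I_k -> triple int.

Definition point f : 'cV[R]_(k * 3).+1 := glue (fun b => to_real R (f b)).

Definition update f b p : 'I_k -> triple int := fun b' => if b' == b then p else f b'.

Lemma in_point f : in_polyhedron (gadgets R k) (point f) <-> forall b, feasible (f b).
Proof. by rewrite in_gadgets; split=> H b; have := H b; rewrite feasible_to_real. Qed.

Lemma eq_point f g : f =1 g -> point f = point g.
Proof. by move=> fg; apply: eq_glue => b; rewrite fg. Qed.

Lemma point_inj f g : point f = point g -> f =1 g.
Proof.
move=> /glue_inj E b; apply: triple_eq => i i4.
have := congr1 (fun p => crd p i) (E b).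
by rewrite !crd_to_real => /eqP; rewrite eqr_int => /eqP.
Qed.

Lemma move_single f b g (t : R) b' :
  move (to_real R (f b')) t (single R b g b') =
  if b' == b then move (to_real R (f b)) t (to_real R g) else to_real R (f b').
Proof.
rewrite /single; case: eqP => [->//|_]; apply: triple_eq => i i4.
by rewrite crd_move crd0 mulr0 addr0.
Qed.

Lemma in_move_point f b g (t : R) : (forall b, feasible (f b)) ->
  g \in directions -> 0 <= t ->
  in_polyhedron (gadgets R k) (point f + t *: glue (single R b g)) <->
  t <= (max_step (f b) g)%:~R.
Proof.
move=> ff gD t0; rewrite glue_move in_gadgets; split=> [/(_ b)|tM b'].
  by rewrite move_single eqxx feasible_move.
rewrite move_single; case: ifP => _; first by rewrite feasible_move.
by rewrite feasible_to_real.
Qed.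

Lemma move_point f b g (m : int) :
  point f + m%:~R *: glue (single R b g) = point (update f b (move (f b) m g)).
Proof.
rewrite glue_move; apply: eq_glue => b'; rewrite move_single /update.
by case: eqP => // _; rewrite to_real_move.
Qed.

Lemma circuit_step_nexts f u : (forall b, feasible (f b)) ->
  in_polyhedron (gadgets R k) u -> circuit_step (gadgets R k) (point f) u ->
  exists b q, q \in nexts (f b) /\ u = point (update f b q).
Proof.
move=> ff uP [g [a [/circuit_single[b [h [hD ->]]] a0 uE amax]]].
have {}uE : u = point f + a *: glue (single R b h) by rewrite -uE addrC subrK.
have aM : a <= (max_step (f b) h)%:~R.
  by apply/(in_move_point b ff hD (ltW a0)); rewrite -uE.
(* Were [a] smaller, the point at parameter [max_step (f b) h] would be feasible, against the
   maximality of the step. *)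
have Ma : a = (max_step (f b) h)%:~R.
  apply/eqP; rewrite eq_le aM leNgt; apply/negP => /amax; apply.
  by apply/in_move_point => //; apply: le_trans aM; apply: ltW.
rewrite uE Ma move_point; exists b, (move (f b) (max_step (f b) h) h); split=> //.
apply/mapP; exists h => //; rewrite mem_filter hD andbT.
by rewrite -(ltr_int R) -Ma.
Qed.

Lemma nexts_circuit_step f b q : (forall b, feasible (f b)) -> q \in nexts (f b) ->
  circuit_step (gadgets R k) (point f) (point (update f b q)) /\
  forall b', feasible (update f b q b').
Proof.
move=> ff /mapP[h]; rewrite mem_filter => /andP[M0 hD] ->.
have Mpos : 0 < (max_step (f b) h)%:~R :> R by rewrite ltr0z.
rewrite -move_point; split; last first.
  by apply/in_point; rewrite -move_point; apply/in_move_point => //; apply: ltW.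
exists (glue (single R b h)), (max_step (f b) h)%:~R; split => //.
- exact: single_circuit.
- by rewrite addrC addKr.
move=> t Mt tP; have t0 : 0 <= t by apply: ltW; apply: lt_trans Mt.
by have := (in_move_point b ff hD t0).1 tP; rewrite leNgt Mt.
Qed.

(** Each step changes one block by a gadget step, so [l b] counts the steps made in block [b].
    Feasibility of [w] is assumed because a walk only asserts it for the points before the last. *)
Lemma walk_blocks m f w : circuit_walk (gadgets R k) m (point f) w ->
  in_polyhedron (gadgets R k) w ->
  exists g (l : 'I_k -> nat), [/\ w = point g, (\sum_b l b)%N = m &
    forall b, g b \in iter (l b) expand [:: f b]].
Proof.
move=> [y [y0 ym ys]] wP.
have yP i : (i <= m)%N -> in_polyhedron (gadgets R k) (y i).
  by rewrite leq_eqVlt => /orP[/eqP->|/ys[]//]; rewrite ym.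
rewrite -ym; elim: m {ym} ys yP => [|m IHm] ys yP.
  by exists f, (fun=> 0%N); split => //=; rewrite ?big1 // => b; rewrite mem_seq1.
have [i im|i im|g [l [yg lm gl]]] := IHm; first exact/ys/ltnW.
  exact/yP/leqW.
have [Py Sy] := ys m (ltnSn m); rewrite yg in Py Sy.
have /in_point gP := Py.
have [b [q [qn ->]]] := circuit_step_nexts gP (yP _ (leqnn _)) Sy.
exists (update g b q), (fun b' => (l b' + (b' == b))%N); split => //.
  rewrite big_split /= lm (bigD1 b) //= eqxx big1 => [|b' /negPf->//].
  by rewrite addn0 addn1.
move=> b'; rewrite /update; case: eqP => [->|_]; last by rewrite addn0.
by rewrite addn1 iterS; apply: mem_expand qn.
Qed.

Lemma iter_expand_walk m f b q : (forall b, feasible (f b)) ->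
  q \in iter m expand [:: f b] ->
  circuit_walk (gadgets R k) m (point f) (point (update f b q)) /\ feasible q.
Proof.
move=> ff; elim: m q => [|m IHm] q /=.
  rewrite mem_seq1 => /eqP ->; split=> //; exists (fun=> point f); split => //.
  by apply: eq_point => b'; rewrite /update; case: eqP => [->|].
case/expandP => p /IHm[Wp fp] qp.
have pP b' : feasible (update f b p b') by rewrite /update; case: ifP.
have [|S Q] := @nexts_circuit_step (update f b p) b q pP; first by rewrite /update eqxx.
have E : update (update f b p) b q =1 update f b q.
  by move=> b'; rewrite /update; case: eqP.
split; last by have := Q b; rewrite E /update eqxx.
rewrite -(addn1 m); apply: (walk_cat Wp).
exists (fun i => if i is 0 then point (update f b p) else point (update f b q)).
split=> // -[|//] _; split; first exact/in_point.
by rewrite -(eq_point E).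
Qed.

Lemma vertices_walk f g : (forall b, f b \in vertices) -> (forall b, g b \in vertices) ->
  exists2 m, circuit_walk (gadgets R k) m (point f) (point g) & (m <= 4 * k)%N.
Proof.
move=> fV gV; have vf p : p \in vertices -> feasible p.
  by rewrite mem_filter => /andP[/andP[]].
(* The blocks are treated one after the other; [s] lists those already brought to their target, at a
   cost of at most four steps each. *)
suff H (s : seq 'I_k) : uniq s -> exists2 m, circuit_walk (gadgets R k) m (point f)
    (point (fun b => if b \in s then g b else f b)) & (m <= 4 * size s)%N.
  have [m W mk] := H (enum 'I_k) (enum_uniq _).
  exists m; last by rewrite size_enum_ord in mk.
  have <- : point (fun b => if b \in enum 'I_k then g b else f b) = point g => //.
  by apply: eq_point => b; rewrite mem_enum.
elim: s => [_|b s IHs /= /andP[bs us]].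
  by exists 0%N => //; exists (fun=> point f).
have [m W mk] := IHs us; set h := (fun b : 'I_k => _) in W.
have hP b' : feasible (h b') by rewrite /h; case: ifP => _; apply: vf.
have hb : h b = f b by rewrite /h (negbTE bs).
have := allP (allP vertices_within_expand4 _ (fV b)) _ (gV b).
move=> /flattenP[t /trajectP[l l5 ->]]; rewrite -hb => /(iter_expand_walk hP)[W' _].
exists (m + l)%N; last by rewrite mulnS addnC leq_add.
have E : update h b (g b) =1 fun b' => if b' \in b :: s then g b' else f b'.
  by move=> b'; rewrite /update inE /h; case: eqP => [->|].
by rewrite -(eq_point E); apply: walk_cat W'.
Qed.

Lemma vertex_point u : vertex (gadgets R k) u ->
  exists2 f, u = point f & forall b, f b \in vertices.
Proof.
move=> [uP uV]; have [_ /glueP[F uF]] := (in_dual_network_flow _ _).1 uP.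
move: uP; rewrite uF => /in_gadgets FP.
have FT b : exists q, q \in vertices /\ F b = to_real R q.
  have [|q] := tight_integral (FP b); last by exists q.
  (* If [g] were not tight in block [b], moving that block alone by [t] and by [- t] would present
     the vertex as the midpoint of two other feasible points. *)
  move=> g gS; apply/negPn/negP => /(perturb (FP b) gS)[t t0 [tP tN]].
  pose G b' : triple R := if b' == b then to_real R g else 0.
  have P s : feasible (move (F b) s (to_real R g)) ->
      in_polyhedron (gadgets R k) (glue F + s *: glue G).
    move=> sP; rewrite glue_move; apply/in_gadgets => b'.
    rewrite /G; case: eqP => [->//|_]; have -> : move (F b') s 0 = F b' => //.
    by apply: triple_eq => i i4; rewrite crd_move crd0 mulr0 addr0.
  have [||+ _] := uV _ _ (2^-1) (P _ tP) (P _ tN).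
  - by apply/andP; split; lra.
  - rewrite uF; apply/colP => x; rewrite !mxE; lra.
  move/eqP; rewrite uF -subr_eq0 addrC addKr scaler_eq0 gt_eqF //= => /eqP G0.
  have [i i4 gi] : exists2 i, (i < 4)%N & crd g i != 0.
    have := mem_directions gS => /(allP directions_sign)/hasP[s s1 /andP[_ /hasP[i]]].
    rewrite mem_iota => i4 /eqP gi; exists i => //; rewrite gi.
    by move: s1; rewrite !inE => /orP[] /eqP->.
  have : glue G (node b i) 0 = 0 by rewrite G0 mxE.
  by rewrite glueE // /G eqxx crd_to_real => /eqP; rewrite intr_eq0 (negbTE gi).
have [f Hf] := choice FT; exists f => [|b]; last by have [] := Hf b.
by apply: eq_glue => b; have [_ ->] := Hf b.
Qed.

Lemma point_vertex f : (forall b, f b \in vertices) -> vertex (gadgets R k) (point f).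
Proof.
move=> fV; split.
  by apply/in_point => b; have := fV b; rewrite mem_filter => /andP[/andP[]].
have H x y (t : R) : in_polyhedron (gadgets R k) x -> in_polyhedron (gadgets R k) y ->
    0 < t < 1 -> point f = t *: x + (1 - t) *: y -> x = point f.
  move=> xP yP /andP[t0 t1].
  have [_ /glueP[X xX]] := (in_dual_network_flow _ _).1 xP.
  have [_ /glueP[Y yY]] := (in_dual_network_flow _ _).1 yP.
  move: xP yP; rewrite xX yY => /in_gadgets XP /in_gadgets YP E.
  apply: eq_glue => b; apply: (vertices_rigid (fV b) (XP b) (YP b) t0 t1) => i i4.
  have /colP/(_ (node b i)) := E.
  by rewrite [RHS]mxE [X in X + _]mxE [X in _ + X]mxE !glueE.
move=> x y t xP yP t01 E; split; first exact: (H x y t).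
apply: (H y x (1 - t)) => //; first by move: t01 => /andP[]; lra.
by rewrite E subKr addrC.
Qed.

(** Every block has to travel from [far_start] to [far_end] by its own steps, at least four of them,
    and these counts add up to [m]. *)
Lemma far_walk m :
  circuit_walk (gadgets R k) m (point (fun=> far_start)) (point (fun=> far_end)) ->
  (4 * k <= m)%N.
Proof.
have [wP _] := @point_vertex (fun=> far_end) (fun=> isT).
move=> /walk_blocks/(_ wP)[g [l [/point_inj gE <- gl]]].
rewrite mulnC -[X in (X * _)%N]card_ord -sum_nat_const; apply: leq_sum => b _.
rewrite leqNgt; apply/negP => lb.
have /negP[] : far_end \notin iter (l b) expand [:: far_start].
  by apply: (allP far_end_notin_expand); apply/trajectP; exists (l b).
by have := gl b; rewrite -gE.
Qed.

End Walks.

Unset Implicit Arguments.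

Theorem mainTheorem4 (R : realType) (k : nat) (hk : (1 <= k)%N) :
  exists (n : nat) (E : {set 'I_n.+1 * 'I_n.+1}) (c : 'cV[R]_#|E|) (D : nat),
    [/\ #|'I_n.+1| = (3 * k + 1)%N,
        loopless E /\ connected_digraph E,
        is_circuit_diameter (dual_network_flow c) D,
        (4 * k <= D)%N &
        (4 * k = #|'I_n.+1| + k - 1)%N].
Proof.
exists (k * 3)%N, (arcs k), (cost R k), (4 * k)%N.
rewrite card_ord; split=> //; try lia.
  by split; [apply: loopless_arcs | apply: connected_arcs].
split; last first.
  move=> u v /vertex_point[f -> fV] /vertex_point[g -> gV].
  have [m W mk] := vertices_walk R fV gV.
  by have [d Hd dm] := walk_circuit_distance W; exists d => //; apply: leq_trans mk.
exists (point R (fun=> far_start)), (point R (fun=> far_end)).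
split; try by apply: point_vertex.
have [m W mk] :=
  @vertices_walk R k (fun=> far_start) (fun=> far_end) (fun=> isT) (fun=> isT).
split; last exact: far_walk.
(* The upper bound of [vertices_walk] and the lower bound of [far_walk] meet, so this walk has
   length exactly [4 * k]. *)
by have /eqP <- : m == (4 * k)%N by rewrite eqn_leq mk (far_walk W).
Qed.
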